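(* Let $X_1$ and $X_2$ be two strong fuzzy incidence graphs with vertex sets $V_1$ and $V_2$, and let $D_1$ and $D_2$ be strong incidence dominating sets of $X_1$ and $X_2$ respectively. Let $X=X_1\times X_2$ be the Cartesian product. Then $D_1\times V_2$ and $V_1\times D_2$ are strong incidence dominating sets of $X$, and $$\gamma_{IS}(X)\le \min\{W(D_1\times V_2),\,W(V_1\times D_2)\}.$$
   Context: Fuzzy incidence graphs. All graphs are finite, simple and undirected; $\wedge$ denotes minimum. A fuzzy incidence graph (FIG) $X=(V,E,I,\varepsilon,\rho,\eta)$ consists of a nonempty finite vertex set $V$, a set $E$ of edges $xy=yx$ ($x\neq y$ in $V$), a set $I$ of (incidence) pairs $(x,xy)$ with $xy\in E$ and $x$ an endpoint of $xy$, and functions $\varepsilon:V\to(0,1]$, $\rho:E\to(0,1]$, $\eta:I\to(0,1]$ with $\rho(xy)\le\varepsilon(x)\wedge\varepsilon(y)$ for all $xy\in E$ and $\eta(x,xy)\le\varepsilon(x)\wedge\rho(xy)$ for all $(x,xy)\in I$ (vertices, edges, pairs of weight $0$ are regarded as absent). The number $\eta(x,xy)$ is the weight of the pair $(x,xy)$. Strong pairs. For $(a,ab)\in I$, an incidence path from $a$ to $ab$ in $X\setminus(a,ab)$ is a sequence $x_0=a,(x_0,x_0x_1),x_0x_1,(x_1,x_0x_1),x_1,\dots,x_k=b,(b,ab),ab$ with $k\ge2$, the vertices $x_0,\dots,x_k$ distinct, and all listed edges in $E$ and pairs in $I$; its incidence strength is the minimum weight of its pairs. $ICONN_{X\setminus(a,ab)}(a,ab)$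 is the maximum incidence strength over all such paths ($0$ if there are none). The pair $(a,ab)$ is strong if $\eta(a,ab)\ge ICONN_{X\setminus(a,ab)}(a,ab)$. A strong fuzzy incidence graph (SFIG) is a FIG all of whose pairs are strong. Domination. In a FIG $X$, a vertex $y$ is a strong incidence neighbor of $x$ if $xy\in E$ and both $(x,xy),(y,xy)$ are in $I$ and strong; $N_{IS}(x)$ is the set of strong incidence neighbors of $x$. A set $D\subseteq V$ is a strong incidence dominating set (SIDS) if every $x\in V\setminus D$ is a strong incidence neighbor of some $y\in D$. Its weight is $W(D)=\sum_{x\in D}\min_{y\in N_{IS}(x)}\eta(x,xy)$ (a vertex with $N_{IS}(x)=\emptyset$ contributes $0$). The strong incidence domination number $\gamma_{IS}(X)$ is the minimum weight of a SIDS of $X$. Cartesian product. For FIGs $X_i=(V_i,E_i,I_i,\varepsilon_i,\rho_i,\eta_i)$, $i=1,2$, the Cartesian product $X_1\times X_2=(V,E,I,\varepsilon,\rho,\eta)$ has $V=V_1\times V_2$; $E=\{(a_1,b_1)(a_2,b_2): a_1=a_2,\ b_1b_2\in E_2\ \text{or}\ a_1a_2\in E_1,\ b_1=b_2\}$; $I$ is the set of pairs $((a_1,b_1),(a_1,b_1)(a_2,b_2))$ such that either $a_1=a_2$ and both $(b_1,b_1b_2),(b_2,b_1b_2)\in I_2$, or $b_1=b_2$ and both $(a_1,a_1a_2),(a_2,a_1a_2)\in I_1$; $\varepsilon(a,b)=\varepsilon_1(a)\wedge\varepsilon_2(b)$; $\rho((a_1,b_1)(a_2,b_2))$ equals $\varepsilon_1(a_1)\wedge\rho_2(b_1b_2)$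 if $a_1=a_2$, and $\rho_1(a_1a_2)\wedge\varepsilon_2(b_1)$ if $b_1=b_2$; $\eta((a_1,b_1),(a_1,b_1)(a_2,b_2))$ equals $\varepsilon_1(a_1)\wedge\eta_2(b_1,b_1b_2)$ if $a_1=a_2$, and $\eta_1(a_1,a_1a_2)\wedge\varepsilon_2(b_1)$ if $b_1=b_2$. In the claim, $W$ is the weight in $X_1\times X_2$. *)

(* Defs.v *)
From HB Require Import structures.
From mathcomp Require Import all_boot all_order all_algebra.
From mathcomp Require Import reals.

Set Implicit Arguments.
Unset Strict Implicit.
Unset Printing Implicit Defensive.

Import Order.TTheory GRing.Theory Num.Theory.

Local Open Scope ring_scope.

(* The vertex set is the whole finite type V.  The edge xy is encoded by the
   symmetric relation [edge x y], and the incidence pair (x, xy) by the ordered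
   pair of x and the other endpoint y: [inc x y] says that (x, xy) is in I, and
   [eta x y] is its weight.  Values of [rho] off E and of [eta] off I are
   irrelevant. *)
Record fig (R : realType) (V : finType) := Fig {
  edge : rel V;
  inc : rel V;
  eps : V -> R;
  rho : V -> V -> R;
  eta : V -> V -> R;
  fig_nonempty : (0 < #|V|)%N;
  edge_sym : forall x y, edge x y = edge y x;
  edge_irrefl : forall x, ~~ edge x x;
  inc_edge : forall x y, inc x y -> edge x y;
  eps_range : forall x, 0 < eps x <= 1;
  rho_sym : forall x y, edge x y -> rho x y = rho y x;
  rho_range : forall x y, edge x y -> 0 < rho x y <= 1;
  eta_range : forall x y, inc x y -> 0 < eta x y <= 1;
  rho_le : forall x y, edge x y -> rho x y <= Num.min (eps x) (eps y);
  eta_le : forall x y, inc x y -> eta x y <= Num.min (eps x) (rho x y)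
}.

Section Domination.
Variables (R : realType) (V : finType) (X : fig R V).

Definition inc_step : rel V :=
  fun x y => [&& edge X x y, inc X x y & inc X y x].

(* [s] lists x_1, ..., x_k; the starting vertex x_0 = a is not in the list.
   Since k >= 2 and the vertices are distinct, no step uses the edge ab, so the
   path automatically lies in X \ (a, ab). *)
Definition is_inc_path (a b : V) (s : seq V) : bool :=
  [&& (1 < size s)%N, uniq (a :: s), path inc_step a s, last a s == b,
      edge X a b & inc X b a].

(* Minimum over the final pair (b, ab) and the two pairs of each step; the steps
   (x_i, x_(i+1)) are the entries of [zip (a :: s) s]. *)
Definition inc_strength (a b : V) (s : seq V) : R :=
  \big[Num.min/eta X b a]_(p <- zip (a :: s) s)
     Num.min (eta X p.1 p.2) (eta X p.2 p.1).

(* Distinctness of the vertices bounds the length of [s] by #|V|.  Strengths of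
   paths are positive, so the default 0 only matters when there is no path. *)
Definition iconn (a b : V) : R :=
  \big[Num.max/0]_(s : #|V|.-bseq V | is_inc_path a b s) inc_strength a b s.

Definition strong (a b : V) : bool := inc X a b && (iconn a b <= eta X a b).

Definition is_sfig : bool := [forall a, forall b, inc X a b ==> strong a b].

Definition strong_nbrs (x : V) : {set V} :=
  [set y | [&& edge X x y, strong x y & strong y x]].

Definition is_sids (D : {set V}) : bool :=
  [forall (x | x \notin D), exists y in D, x \in strong_nbrs y].

(* All pair weights are at most 1, so 1 is neutral for the inner minimum. *)
Definition min_weight (x : V) : R :=
  if strong_nbrs x == set0 then 0
  else \big[Num.min/1]_(y in strong_nbrs x) eta X x y.

Definition weight (D : {set V}) : R := \sum_(x in D) min_weight x.

(* [set: V] is itself a strong incidence dominating set, so seeding the minimum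
   with its weight does not change it. *)
Definition gamma_is : R :=
  \big[Num.min/weight [set: V]]_(D : {set V} | is_sids D) weight D.

End Domination.

Section CartesianProduct.
Variables (R : realType) (V1 V2 : finType) (X1 : fig R V1) (X2 : fig R V2).

Definition prod_edge : rel (V1 * V2) := fun u v =>
  (u.1 == v.1) && edge X2 u.2 v.2 || edge X1 u.1 v.1 && (u.2 == v.2).

Definition prod_inc : rel (V1 * V2) := fun u v =>
  [&& u.1 == v.1, inc X2 u.2 v.2 & inc X2 v.2 u.2] ||
  [&& u.2 == v.2, inc X1 u.1 v.1 & inc X1 v.1 u.1].

Definition prod_eps (u : V1 * V2) : R := Num.min (eps X1 u.1) (eps X2 u.2).

(* On edges the two cases u.1 = v.1 and u.2 = v.2 are exclusive. *)
Definition prod_rho (u v : V1 * V2) : R :=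
  if u.1 == v.1 then Num.min (eps X1 u.1) (rho X2 u.2 v.2)
  else Num.min (rho X1 u.1 v.1) (eps X2 u.2).

Definition prod_eta (u v : V1 * V2) : R :=
  if u.1 == v.1 then Num.min (eps X1 u.1) (eta X2 u.2 v.2)
  else Num.min (eta X1 u.1 v.1) (eps X2 u.2).

Lemma prod_nonempty : (0 < #|{: V1 * V2}|)%N.
Proof. by rewrite card_prod muln_gt0 (fig_nonempty X1) (fig_nonempty X2). Qed.

Lemma prod_edge_sym u v : prod_edge u v = prod_edge v u.
Proof.
by rewrite /prod_edge (eq_sym u.1) (eq_sym u.2) (edge_sym X1) (edge_sym X2).
Qed.

Lemma prod_edge_irrefl u : ~~ prod_edge u u.
Proof.
by rewrite /prod_edge !eqxx andbT negb_or (edge_irrefl X1) (edge_irrefl X2).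
Qed.

Lemma prod_inc_edge u v : prod_inc u v -> prod_edge u v.
Proof.
rewrite /prod_edge; case/orP=> /and3P[-> /inc_edge -> _] //.
by rewrite orbT.
Qed.

Let min_range (x y : R) :
  0 < x <= 1 -> 0 < y <= 1 -> 0 < Num.min x y <= 1.
Proof.
by case/andP=> x0 x1 /andP[y0 y1]; rewrite lt_min x0 y0 ge_min x1.
Qed.

Lemma prod_edgeP u v : prod_edge u v ->
  (u.1 = v.1 /\ edge X2 u.2 v.2) \/
  [/\ (u.1 == v.1) = false, edge X1 u.1 v.1 & u.2 = v.2].
Proof.
case/orP=> /andP[]; first by move=> /eqP ? ?; left.
move=> e /eqP ?; right; split=> //.
by apply/negP => /eqP uv; move: e; rewrite uv (negbTE (edge_irrefl X1 _)).
Qed.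

Lemma prod_incP u v : prod_inc u v ->
  (u.1 = v.1 /\ inc X2 u.2 v.2) \/
  [/\ (u.1 == v.1) = false, inc X1 u.1 v.1 & u.2 = v.2].
Proof.
case/orP=> /and3P[/eqP e i _]; first by left.
right; split=> //; apply/negP => /eqP uv; have := inc_edge i.
by rewrite uv (negbTE (edge_irrefl X1 _)).
Qed.

Lemma prod_eps_range u : 0 < prod_eps u <= 1.
Proof. by apply: min_range; apply: eps_range. Qed.

Lemma prod_rho_sym u v : prod_edge u v -> prod_rho u v = prod_rho v u.
Proof.
rewrite /prod_rho => /prod_edgeP[[-> e]|[ne e ->]].
  by rewrite eqxx (rho_sym e).
by rewrite ne (eq_sym v.1) ne (rho_sym e).
Qed.

Lemma prod_rho_range u v : prod_edge u v -> 0 < prod_rho u v <= 1.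
Proof.
rewrite /prod_rho => /prod_edgeP[[-> e]|[-> e _]].
  by rewrite eqxx; apply: min_range; [apply: eps_range | apply: rho_range].
by apply: min_range; [apply: rho_range | apply: eps_range].
Qed.

Lemma prod_eta_range u v : prod_inc u v -> 0 < prod_eta u v <= 1.
Proof.
rewrite /prod_eta => /prod_incP[[-> i]|[-> i _]].
  by rewrite eqxx; apply: min_range; [apply: eps_range | apply: eta_range].
by apply: min_range; [apply: eta_range | apply: eps_range].
Qed.

Lemma prod_rho_le u v :
  prod_edge u v -> prod_rho u v <= Num.min (prod_eps u) (prod_eps v).
Proof.
rewrite /prod_rho /prod_eps => /prod_edgeP[[-> e]|[-> e ->]].
  have := rho_le e; rewrite eqxx !le_min => /andP[h1 h2].
  by rewrite !ge_min lexx h1 h2 !orbT.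
have := rho_le e; rewrite !le_min => /andP[h1 h2].
by rewrite !ge_min lexx h1 h2 !orbT.
Qed.

Lemma prod_eta_le u v :
  prod_inc u v -> prod_eta u v <= Num.min (prod_eps u) (prod_rho u v).
Proof.
rewrite /prod_eta /prod_rho /prod_eps => /prod_incP[[-> i]|[-> i ->]].
  have := eta_le i; rewrite eqxx !le_min => /andP[h1 h2].
  by rewrite !ge_min lexx h1 h2 !orbT.
have := eta_le i; rewrite !le_min => /andP[h1 h2].
by rewrite !ge_min lexx h1 h2 !orbT.
Qed.

Definition fig_prod : fig R (V1 * V2)%type :=
  Fig prod_nonempty prod_edge_sym prod_edge_irrefl prod_inc_edge
      prod_eps_range prod_rho_sym prod_rho_range prod_eta_range
      prod_rho_le prod_eta_le.

End CartesianProduct.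

(* Main.v *)
Require Import Defs.
From mathcomp Require Import all_boot all_order all_algebra.
From mathcomp Require Import reals.
Set Implicit Arguments.
Unset Strict Implicit.
Unset Printing Implicit Defensive.

Import Order.TTheory GRing.Theory Num.Theory.
Local Open Scope ring_scope.

(** A strong pair of a factor stays strong in every fibre of the product.  An
    incidence path of strength t from (a, c) to (b, c) projects to a walk from
    a to b in the factor all of whose steps have weight at least t.  Removing
    loops leaves either the single step ab, whose own pairs then have weight at
    least t, or an incidence path of length at least 2, to which the strength
    of (a, ab) in the factor applies.  The cap by the weight of the fixed
    coordinate c is harmless, since the final pair of the path carries it. *)

Section IncidenceStrength.
Variables (R : realType) (V : finType) (X : fig R V).
Implicit Types (a b x y : V) (s : seq V) (t : R).

Lemma inc_stepC x y : inc_step X x y = inc_step X y x.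
Proof. by rewrite /inc_step edge_sym [inc X x y && _]andbC. Qed.

(** Thresholding by [t] turns a bound on the strength of a path into a path condition, which
    survives loop removal and projection. *)
Definition thick_step t : rel V :=
  fun x y => inc_step X x y && (t <= Num.min (eta X x y) (eta X y x)).

Lemma path_thick_step t a b s : path (inc_step X) a s ->
  (t <= inc_strength X a b s) = (t <= eta X b a) && path (thick_step t) a s.
Proof.
rewrite /inc_strength; move: (eta X b a) => e.
elim: s a => [|x s IHs] a /=; first by rewrite big_nil andbT.
move=> /andP[ax xs]; rewrite big_cons le_min /= IHs // /thick_step ax /=.
by rewrite andbCA.
Qed.

Lemma strong_thick_path t a b s : strong X a b -> inc X b a ->
  t <= eta X b a -> path (thick_step t) a s -> last a s = b ->
  t <= eta X a b.
Proof.
move=> /andP[iab ab] iba tba as_thick; case: (shortenP as_thick) => r.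
case: r => [|x [|y r]] ar r_uniq _ //= rb.
- by have := inc_edge iab; rewrite -rb (negbTE (edge_irrefl X a)).
- by move: ar; rewrite /= /thick_step rb le_min andbT => /and3P[].
set q := [:: x, y & r] in ar r_uniq rb.
have q_path : path (inc_step X) a q.
  by apply: sub_path ar => u v /andP[].
(* A path without repetitions fits into the bounded sequences over which [iconn] is a maximum. *)
have q_size : (size q <= #|V|)%N.
  by apply: ltnW; rewrite -[_.+1]/(size (a :: q)) -(card_uniqP r_uniq) max_card.
have q_inc : is_inc_path X a b q.
  apply/and5P; split=> //; first exact/eqP.
  by rewrite iba (inc_edge iab).
apply: le_trans ab; apply: (@le_trans _ _ (inc_strength X a b q)).
  by rewrite path_thick_step // tba.
exact: (@le_bigmax_cond _ _ _ 0 (Bseq q_size)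
  (fun s : #|V|.-bseq V => is_inc_path X a b s)
  (fun s : #|V|.-bseq V => inc_strength X a b s)).
Qed.

(** The bound has to be nonnegative because the maximum takes the default 0 when there is no
    path. *)
Lemma iconn_leP a b t : 0 <= t ->
  (forall s, is_inc_path X a b s -> inc_strength X a b s <= t) ->
  iconn X a b <= t.
Proof. by move=> t0 st; apply: bigmax_le => // s /st. Qed.

Lemma gamma_is_le D : is_sids X D -> gamma_is X <= weight X D.
Proof. exact: bigmin_le_cond. Qed.

End IncidenceStrength.

Section Projection.
Variables (R : realType) (W V : finType) (X : fig R W) (Y : fig R V).
Variable p : W -> V.
(** Abstracts what the two coordinate projections share, so that one argument serves both
    factors. *)
Hypothesis p_step : forall u v, inc_step X u v -> p u = p v \/
  inc_step Y (p u) (p v) /\ eta X u v <= eta Y (p u) (p v).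

Lemma thick_walk_proj t u s : path (thick_step X t) u s ->
  exists2 r, path (thick_step Y t) (p u) r & last (p u) r = p (last u s).
Proof.
elim: s u => [|v s IHs] u /=; first by exists [::].
move=> /andP[/andP[uv]]; rewrite le_min => /andP[tuv tvu] /IHs[r vr r_last].
have [puv|[puv le_uv]] := p_step uv; first by exists r; rewrite puv.
(* Thickness concerns both pairs of the edge, while [p_step] bounds one weight; the reversed step
   gives the other. *)
have [pvu|[_ le_vu]] := p_step (etrans (inc_stepC X v u) uv).
  by exists r; rewrite -pvu.
exists (p v :: r) => //=.
by rewrite vr /thick_step puv le_min (le_trans tuv) ?(le_trans tvu).
Qed.

(** The term [eta X v u] is the weight of the final pair of every path, hence at least its strength;
    the projected walk bounds the strength by the other term. *)
Lemma strong_proj (u v : W) : inc_step X u v ->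
  strong Y (p u) (p v) -> inc Y (p v) (p u) ->
  Num.min (eta Y (p u) (p v)) (eta X v u) <= eta X u v -> strong X u v.
Proof.
move=> uv puv ivu le_uv; have /and3P[_ xuv xvu] := uv.
rewrite /strong xuv; apply: iconn_leP => [|s].
  by have /andP[/ltW] := eta_range xuv.
move=> /and5P[_ _ us /eqP s_last _]; apply: le_trans le_uv.
have := lexx (inc_strength X u v s); rewrite path_thick_step // le_min.
move=> /andP[t_vu /thick_walk_proj[r ur]]; rewrite s_last => r_last.
rewrite t_vu andbT; apply: strong_thick_path ur r_last => //.
(* The final pair projects to one of at least the same weight; a collapse would make the edge from
   [p u] to [p v] a loop. *)
have [pvu|[_]] := p_step (etrans (inc_stepC X v u) uv); last exact: le_trans.
have /andP[/inc_edge] := puv.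
by rewrite pvu (negbTE (edge_irrefl Y _)).
Qed.

End Projection.

Section CartesianProductStrong.
Variables (R : realType) (V1 V2 : finType) (X1 : fig R V1) (X2 : fig R V2).
Let X := fig_prod X1 X2.

Lemma inc_step_prodl a b c : inc_step X1 a b -> inc_step X (a, c) (b, c).
Proof.
move=> /and3P[ab iab iba]; rewrite /inc_step /= /prod_edge /prod_inc /=.
by rewrite eqxx ab iab iba !orbT.
Qed.

Lemma inc_step_prodr a b c : inc_step X2 b c -> inc_step X (a, b) (a, c).
Proof.
move=> /and3P[bc ibc icb]; rewrite /inc_step /= /prod_edge /prod_inc /=.
by rewrite eqxx bc ibc icb.
Qed.

Lemma inc_step_fst u v : inc_step X u v -> u.1 = v.1 \/
  inc_step X1 u.1 v.1 /\ eta X u v <= eta X1 u.1 v.1.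
Proof.
move=> /and3P[_ /orP[/and3P[/eqP -> _ _]|/and3P[_ iuv ivu]] _]; first by left.
have [->|uv] := eqVneq u.1 v.1; [by left | right].
by rewrite /inc_step (inc_edge iuv) iuv ivu /= /prod_eta (negbTE uv) ge_min lexx.
Qed.

Lemma inc_step_snd u v : inc_step X u v -> u.2 = v.2 \/
  inc_step X2 u.2 v.2 /\ eta X u v <= eta X2 u.2 v.2.
Proof.
move=> /and3P[_ /orP[/and3P[uv iuv ivu]|/and3P[/eqP -> _ _]] _]; last by left.
by right; rewrite /inc_step (inc_edge iuv) iuv ivu /= /prod_eta uv ge_min lexx orbT.
Qed.

Lemma strong_prodl a b c :
  strong X1 a b -> inc X1 b a -> strong X (a, c) (b, c).
Proof.
move=> sab iba; have /andP[iab _] := sab.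
have ab : (a == b) = false.
  by apply/eqP => ab; have := inc_edge iab; rewrite ab (negbTE (edge_irrefl X1 b)).
apply: (@strong_proj _ _ _ X X1 fst inc_step_fst) => //.
  by apply: inc_step_prodl; rewrite /inc_step (inc_edge iab) iab.
(* The weight of the reversed pair is capped by [eps X2 c], so the minimum lies below both terms of
   the product weight. *)
by rewrite /= /prod_eta /= (eq_sym b) ab le_min !ge_min !lexx !orbT.
Qed.

Lemma strong_prodr a b c :
  strong X2 b c -> inc X2 c b -> strong X (a, b) (a, c).
Proof.
move=> sbc icb; have /andP[ibc _] := sbc.
apply: (@strong_proj _ _ _ X X2 snd inc_step_snd) => //.
  by apply: inc_step_prodr; rewrite /inc_step (inc_edge ibc) ibc.
by rewrite /= /prod_eta /= eqxx le_min !ge_min !lexx !orbT.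
Qed.

(** A vertex [(a, c)] is dominated within its own fibre, by [(b, c)] where [b] in [D] dominates [a]
    in [X1]. *)
Lemma sids_prodl D : is_sids X1 D -> is_sids X (setX D [set: V2]).
Proof.
move=> /forall_inP sD; apply/forall_inP => -[a c].
rewrite !inE andbT => /sD /exists_inP[b bD].
rewrite inE => /and3P[ba sba sab].
apply/exists_inP; exists (b, c); first by rewrite !inE bD.
have [[/andP[iab _]] /andP[iba _]] := (sab, sba).
by rewrite inE !strong_prodl //= /prod_edge /= ba eqxx orbT.
Qed.

Lemma sids_prodr D : is_sids X2 D -> is_sids X (setX [set: V1] D).
Proof.
move=> /forall_inP sD; apply/forall_inP => -[c a].
rewrite !inE => /sD /exists_inP[b bD].
rewrite inE => /and3P[ba sba sab].
apply/exists_inP; exists (c, b); first by rewrite !inE bD.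
have [[/andP[iab _]] /andP[iba _]] := (sab, sba).
by rewrite inE !strong_prodr //= /prod_edge /= ba eqxx.
Qed.

End CartesianProductStrong.

Theorem theorem4p13 (R : realType) (V1 V2 : finType)
    (X1 : fig R V1) (X2 : fig R V2) (D1 : {set V1}) (D2 : {set V2})
    (sfig1 : is_sfig X1) (sfig2 : is_sfig X2)
    (sids1 : is_sids X1 D1) (sids2 : is_sids X2 D2) :
  let X := fig_prod X1 X2 in
  [/\ is_sids X (setX D1 [set: V2]),
      is_sids X (setX [set: V1] D2) &
      gamma_is X <= Num.min (weight X (setX D1 [set: V2]))
                            (weight X (setX [set: V1] D2))].
Proof.
move=> X; have sids_l := sids_prodl X2 sids1.
have sids_r := sids_prodr X1 sids2.
by split=> //; rewrite le_min !gamma_is_le.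
Qed.
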